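(* For every constant $c>1$, $c$-$\textsc{AMGM-LC}\le_{dt}\textsc{Lossy-Code}$ (indeed via a decision tree reduction of $\mathrm{polylog}(N)$ query complexity).
   Context: Query model: inputs are functions between finite sets accessed by querying bits of the encodings of their values; $R\le_{dt}S$ means a reduction in which the $S$-instance's input bits are computed by decision trees over the $R$-input and $S$-solutions are mapped back to $R$-solutions by decision trees, with log of the $S$-input length plus maximum depth at most $\mathrm{polylog}(N)$. $\textsc{Lossy-Code}$: given $f:[M]\to[2M]$ and $g:[2M]\to[M]$, find $x\in[2M]$ with $f(g(x))\neq x$. $c$-$\textsc{AMGM-LC}$: let $V=[2N]$ and $P=[cN^2]$. The input is a coloring $C:V\to\{0,1\}$ and maps $F:P\to V\times V$, $G:V\times V\to P$. Let $H=C^{-1}(0)\times C^{-1}(1)$. A solution is a pigeon $x\in P$ with $G(F(x))\neq x$, or a pigeon $x\in P$ with $F(x)\notin H$. *)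

(* Defs.v *)
From mathcomp Require Import all_boot all_order all_algebra.
From mathcomp Require Import reals.

Set Implicit Arguments.
Unset Strict Implicit.
Unset Printing Implicit Defensive.

Inductive dtree (Q A : Type) : Type :=
| Leaf of A
| Query of Q & (bool -> dtree Q A).

Fixpoint dt_eval (Q A : Type) (oracle : Q -> bool) (t : dtree Q A) : A :=
  match t with
  | Leaf a => a
  | Query q next => dt_eval oracle (next (oracle q))
  end.

Fixpoint dt_depth (Q A : Type) (t : dtree Q A) : nat :=
  match t with
  | Leaf _ => 0
  | Query _ next => (maxn (dt_depth (next false)) (dt_depth (next true))).+1
  end.

(* The positions [position] index the bits of the encoding [bit x] of an
   input [x]; bit strings that encode no element of [input] are not inputs. *)
Record search_problem : Type := SearchProblem {
  input : Type;
  position : finType;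
  bit : input -> position -> bool;
  output : finType;
  is_solution : input -> output -> bool }.

Definition input_length (R : search_problem) : nat := #|position R|.

(* The encodings used below are injective, so the [S]-input [y] computed by
   the trees [T] from the [R]-input [x] is unique. *)
Definition dt_reduces_within (R S : search_problem) (cost : nat) : Prop :=
  exists (T : position S -> dtree (position R) bool)
         (U : output S -> dtree (position R) (output R))
         (d : nat),
    [/\ forall x : input R, exists y : input S,
          (forall q, bit y q = dt_eval (bit x) (T q)) /\
          (forall o, is_solution y o -> is_solution x (dt_eval (bit x) (U o))),
        forall q, dt_depth (T q) <= d,
        forall o, dt_depth (U o) <= d
      & up_log 2 (input_length S) + d <= cost].

(* Size parameters range over positive integers: at size 0 the problems below
   have inputs without any solution.  The bound [k * (up_log 2 N).+1 ^ k] is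
   [polylog N]; the successor makes it meaningful at [N = 1]. *)
Definition dt_reducible (R S : nat -> search_problem) : Prop :=
  exists k : nat, forall N : nat, 0 < N ->
    exists2 M : nat, 0 < M &
      dt_reduces_within (R N) (S M) (k * (up_log 2 N).+1 ^ k).

(* [code_length n] bits suffice for the elements of 'I_n, written in binary. *)
Definition code_length (n : nat) : nat := up_log 2 n.

Definition ord_bit (n : nat) (i : 'I_n) (j : 'I_(code_length n)) : bool :=
  odd (i %/ 2 ^ j).

Record lossy_code_input (M : nat) : Type := LossyCodeInput {
  lc_f : {ffun 'I_M -> 'I_(2 * M)};
  lc_g : {ffun 'I_(2 * M) -> 'I_M} }.

Definition lossy_code_position (M : nat) : finType :=
  ('I_M * 'I_(code_length (2 * M)) + 'I_(2 * M) * 'I_(code_length M))%type.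

Definition lossy_code_bit (M : nat) (x : lossy_code_input M)
    (q : lossy_code_position M) : bool :=
  match q with
  | inl (i, j) => ord_bit (lc_f x i) j
  | inr (i, j) => ord_bit (lc_g x i) j
  end.

Definition lossy_code (M : nat) : search_problem :=
  {| input := lossy_code_input M;
     position := lossy_code_position M;
     bit := @lossy_code_bit M;
     output := 'I_(2 * M);
     is_solution := fun x z => lc_f x (lc_g x z) != z |}.

(* The vertex set [V] is ['I_(2 * N)] and the pigeon set [P] is ['I_p]. *)
Record amgm_lc_input (p N : nat) : Type := AmgmLcInput {
  coloring : {ffun 'I_(2 * N) -> bool};
  amgm_F : {ffun 'I_p -> 'I_(2 * N) * 'I_(2 * N)};
  amgm_G : {ffun 'I_(2 * N) * 'I_(2 * N) -> 'I_p} }.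

Definition amgm_lc_position (p N : nat) : finType :=
  ('I_(2 * N)
   + 'I_p * ('I_(code_length (2 * N)) + 'I_(code_length (2 * N)))
   + ('I_(2 * N) * 'I_(2 * N)) * 'I_(code_length p))%type.

Definition amgm_lc_bit (p N : nat) (x : amgm_lc_input p N)
    (q : amgm_lc_position p N) : bool :=
  match q with
  | inl (inl v) => coloring x v
  | inl (inr (i, inl j)) => ord_bit (amgm_F x i).1 j
  | inl (inr (i, inr j)) => ord_bit (amgm_F x i).2 j
  | inr (e, j) => ord_bit (amgm_G x e) j
  end.

(* The colors 0 and 1 are [false] and [true]. *)
Definition bichromatic (p N : nat) (x : amgm_lc_input p N) :
    {set 'I_(2 * N) * 'I_(2 * N)} :=
  setX (coloring x @^-1: [set false]) (coloring x @^-1: [set true]).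

(* [c * N ^ 2] need not be an integer; it is rounded up, so that there are
   strictly more than [N ^ 2] pigeons whenever [c > 1] and [N > 0]. *)
Definition pigeons (R : realType) (c : R) (N : nat) : nat :=
  `|Num.ceil (c * N%:R ^+ 2)%R|%N.

Definition amgm_lc (R : realType) (c : R) (N : nat) : search_problem :=
  {| input := amgm_lc_input (pigeons c N) N;
     position := amgm_lc_position (pigeons c N) N;
     bit := @amgm_lc_bit (pigeons c N) N;
     output := 'I_(pigeons c N);
     is_solution := fun x i =>
       (amgm_G x (amgm_F x i) != i) || (amgm_F x i \notin bichromatic x) |}.

(* Main.v *)
(* Put K = k + 1 and let A, B be the two color classes.  If no pigeon is a
   solution, the pigeon set P embeds in A x B, so P^K embeds in A^K x B^K, and
   the latter is interleaved in 'C(2K, K) disjoint ways into V^(2K), one for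
   each choice of the K coordinates in A.  A string of V^(2K) determines this
   choice from the colors of its 2K letters, so both directions need few
   queries and, unlike AMGM itself, no counting of A and B.  Finally
   'C(2K, K) >= 4^K / (K + 1), hence
   'C(2K, K) |P|^K >= (c^K / (K + 1)) |V|^(2K) >= 2 |V|^(2K)
   for a constant K depending on c only: this is the factor 2 of Lossy-Code. *)

Require Import Defs.
From mathcomp Require Import all_boot all_order all_algebra.
From mathcomp Require Import reals.
From mathcomp Require Import zify lra.

Set Implicit Arguments.
Unset Strict Implicit.
Unset Printing Implicit Defensive.

(** * Decision trees: composition, depth, and computable functions *)

Fixpoint dt_bind (Q A B : Type) (t : dtree Q A) (k : A -> dtree Q B) :
    dtree Q B :=
  match t with
  | Leaf a => k a
  | Query q next => Query q (fun b => dt_bind (next b) k)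
  end.

Lemma dt_eval_bind (Q A B : Type) (o : Q -> bool) (t : dtree Q A)
    (k : A -> dtree Q B) :
  dt_eval o (dt_bind t k) = dt_eval o (k (dt_eval o t)).
Proof. by elim: t => //= q next ->. Qed.

Lemma dt_depth_bind (Q A B : Type) (e : nat) (t : dtree Q A)
    (k : A -> dtree Q B) :
  (forall a, dt_depth (k a) <= e) ->
  dt_depth (dt_bind t k) <= dt_depth t + e.
Proof.
move=> ke; elim: t => [a|q next IH] //=.
have := IH true; have := IH false; lia.
Qed.

(* Lives in [Type], so that trees can be extracted from a family of instances
   without choice. *)
Definition computable (X Q A : Type) (bit : X -> Q -> bool) (d : nat)
    (h : X -> A) : Type :=
  {t : dtree Q A | dt_depth t <= d /\ forall x, dt_eval (bit x) t = h x}.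

Lemma computable_const (X Q A : Type) (bit : X -> Q -> bool) (a : A) :
  computable bit 0 (fun _ => a).
Proof. by exists (Leaf Q a). Qed.

Lemma computable_query (X Q : Type) (bit : X -> Q -> bool) (q : Q) :
  computable bit 1 (fun x => bit x q).
Proof. by exists (Query q (@Leaf Q bool)). Qed.

(** Adaptive composition: the queries of the second stage may depend on the value [a] found by the
    first, and the depths add up. *)
Lemma computable_bind (X Q A B : Type) (bit : X -> Q -> bool) (d e : nat)
    (h : X -> A) (k : A -> X -> B) :
  computable bit d h -> (forall a, computable bit e (k a)) ->
  computable bit (d + e) (fun x => k (h x) x).
Proof.
case=> t [td th] ck; exists (dt_bind t (fun a => sval (ck a))); split.
  apply: leq_trans (leq_add td (leqnn e)).
  by apply: dt_depth_bind => a; case: (svalP (ck a)).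
by move=> x; rewrite dt_eval_bind th; case: (svalP (ck (h x))).
Qed.

Lemma computable_le (X Q A : Type) (bit : X -> Q -> bool) (d e : nat)
    (h : X -> A) :
  d <= e -> computable bit d h -> computable bit e h.
Proof. by move=> de [t [td th]]; exists t; split=> //; apply: leq_trans de. Qed.

Lemma computable_ext (X Q A : Type) (bit : X -> Q -> bool) (d : nat)
    (h h' : X -> A) :
  h =1 h' -> computable bit d h -> computable bit d h'.
Proof. by move=> hh' [t [td th]]; exists t; split=> // x; rewrite th. Qed.

Lemma computable_map (X Q A B : Type) (bit : X -> Q -> bool) (d : nat)
    (h : X -> A) (k : A -> B) :
  computable bit d h -> computable bit d (fun x => k (h x)).
Proof.
move=> ch; rewrite -(addn0 d).
apply: (computable_bind (k := fun a _ => k a)) ch _ => a.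
exact: computable_const.
Qed.

Lemma computable_ffun (X Q A : Type) (bit : X -> Q -> bool) (d : nat)
    (J : finType) (a0 : A) (h : J -> X -> A) :
  (forall j, computable bit d (h j)) ->
  computable bit (#|J| * d) (fun x => [ffun j => h j x]).
Proof.
move=> ch.
(* Entries are read along a list, with [a0] standing in for those not on it. *)
suff cs (s : seq J) : computable bit (size s * d)
    (fun x => [ffun j => if j \in s then h j x else a0]).
  rewrite cardE; apply: computable_ext (cs (enum J)) => x.
  by apply/ffunP=> j; rewrite !ffunE mem_enum.
elim: s => [|i s IH].
  apply: computable_ext (computable_const _ [ffun => a0]) => x.
  by apply/ffunP=> j; rewrite !ffunE.
rewrite /= mulSn.
apply: computable_ext (computable_bind (ch i)
  (k := fun a x => [ffun j => if j == i then a else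
     [ffun j => if j \in s then h j x else a0] j]) _).
  by move=> x; apply/ffunP=> j; rewrite !ffunE in_cons; case: eqP => [->|].
move=> a.
exact: (computable_map
  (fun w : {ffun J -> A} => [ffun j => if j == i then a else w j]) IH).
Qed.

(** * Binary encodings and search *)

Lemma odd_bits_inj (m a b : nat) :
  a < 2 ^ m -> b < 2 ^ m ->
  (forall j, j < m -> odd (a %/ 2 ^ j) = odd (b %/ 2 ^ j)) -> a = b.
Proof.
elim: m a b => [|m IH] a b; first by rewrite expn0; lia.
rewrite expnS => am bm ab.
have /= := ab 0 isT; rewrite !expn0 !divn1 => ab0.
have ab2 : a./2 = b./2.
  apply: IH; [lia | lia |] => j jm.
  by have := ab j.+1 jm; rewrite !expnS !divnMA !divn2.
by rewrite -(odd_double_half a) -(odd_double_half b) ab0 ab2.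
Qed.

Lemma ord_bit_inj (n : nat) (a b : 'I_n) : ord_bit a =1 ord_bit b -> a = b.
Proof.
move=> ab; apply/val_inj/(@odd_bits_inj (code_length n)).
- by apply: leq_trans (ltn_ord a) _; apply: up_logP.
- by apply: leq_trans (ltn_ord b) _; apply: up_logP.
- by move=> j jn; apply: (ab (Ordinal jn)).
Qed.

Lemma computable_ord (X Q : Type) (bit : X -> Q -> bool) (d n : nat)
    (i0 : 'I_n) (h : X -> 'I_n) :
  (forall j, computable bit d (fun x => ord_bit (h x) j)) ->
  computable bit (code_length n * d) h.
Proof.
move=> ch; have := computable_ffun false ch; rewrite card_ord => cw.
(* [decode] inverts the encoding: [h x] itself matches the bits read, so the default [i0] is never
   returned. *)
pose decode (w : {ffun 'I_(code_length n) -> bool}) :=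
  odflt i0 [pick i | [forall j, ord_bit i j == w j]].
apply: computable_ext (computable_map decode cw) => x; rewrite /decode.
case: pickP => [i /forallP ix|/(_ (h x)) /forallP[]] /=.
  by apply: ord_bit_inj => j; have /eqP := ix j; rewrite ffunE.
by move=> j; rewrite ffunE.
Qed.

Lemma computable_pick (X Q : Type) (bit : X -> Q -> bool) (d : nat)
    (J : finType) (h : J -> X -> bool) :
  (forall j, computable bit d (h j)) ->
  computable bit (#|J| * d) (fun x => [pick j | h j x]).
Proof.
move=> ch; have cw := computable_ffun false ch.
apply: computable_ext
  (computable_map (fun w : {ffun J -> bool} => [pick j | w j]) cw).
by move=> x; apply: eq_pick => j; rewrite ffunE.
Qed.

(** * Reductions to Lossy-Code *)

(** Allows work with values instead of bits: the tree for one bit computes the whole value and keeps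
    that bit. *)
Lemma lossy_code_reduction (R : search_problem) (M d : nat)
    (f : input R -> 'I_M -> 'I_(2 * M)) (g : input R -> 'I_(2 * M) -> 'I_M)
    (u : input R -> 'I_(2 * M) -> output R) :
  (forall i, computable (@bit R) d (f^~ i)) ->
  (forall z, computable (@bit R) d (g^~ z)) ->
  (forall z, computable (@bit R) d (u^~ z)) ->
  (forall x z, f x (g x z) != z -> is_solution x (u x z)) ->
  dt_reduces_within R (lossy_code M)
    (up_log 2 (input_length (lossy_code M)) + d).
Proof.
move=> cf cg cu fg.
have cT (q : lossy_code_position M) : computable (@bit R) d (fun x =>
    lossy_code_bit (LossyCodeInput (finfun (f x)) (finfun (g x))) q).
  case: q => [[i j]|[i j]] /=.
    apply: computable_ext (computable_map (fun z => ord_bit z j) (cf i)) => x.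
    by rewrite ffunE.
  apply: computable_ext (computable_map (fun z => ord_bit z j) (cg i)) => x.
  by rewrite ffunE.
exists (fun q => sval (cT q)), (fun z => sval (cu z)), d; split=> //.
- move=> x; exists (LossyCodeInput (finfun (f x)) (finfun (g x))); split.
    by move=> q; case: (svalP (cT q)) => _ ->.
  by move=> z /=; rewrite !ffunE; case: (svalP (cu z)) => _ ->; apply: fg.
- by move=> q; case: (svalP (cT q)).
- by move=> z; case: (svalP (cu z)).
Qed.

Lemma up_log_lossy_code (M a : nat) :
  M <= 2 ^ a -> up_log 2 (input_length (lossy_code M)) <= a.*2.+2.
Proof.
move=> Ma; apply: up_log_min => //.
(* This crude bound suffices: it makes the input length at most [4 * M ^ 2]. *)
have cl n : code_length n <= n by apply/up_log_min/ltnW/ltn_expl.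
rewrite /input_length /= card_sum !card_prod !card_ord.
have := cl (2 * M); have := cl M.
have -> : 2 ^ a.*2.+2 = 4 * (2 ^ a * 2 ^ a).
  by rewrite -addnn 2!expnS expnD; lia.
have := leq_mul Ma Ma.
set x := code_length _; set y := code_length _ => ? h1 h2.
have := leq_mul (leqnn M) h2; have := leq_mul (leqnn (2 * M)) h1; lia.
Qed.

(** * Interleaving along a set of coordinates *)

Section Placements.

Context (k : nat) (V : Type).
Implicit Types (t : {set 'I_(2 * k.+1)}) (w : {ffun 'I_k.+1 -> V * V})
  (s : {ffun 'I_(2 * k.+1) -> V}).

(** Both [t] and its complement are filled in increasing order of coordinates. This is meant for
    [#|t| = k.+1], which keeps both indices in the range of [inord]. *)
Definition spread t w : {ffun 'I_(2 * k.+1) -> V} :=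
  [ffun i => if i \in t then (w (inord (index i (enum t)))).1
             else (w (inord (index i (enum (~: t))))).2].

Definition gather t s : {ffun 'I_k.+1 -> V * V} :=
  [ffun j : 'I_k.+1 => (s (nth ord0 (enum t) j),
                        s (nth ord0 (enum (~: t)) j))].

Lemma spreadK t w : #|t| = k.+1 -> gather t (spread t w) = w.
Proof.
move=> tk; have tCk : #|~: t| = k.+1.
  by have := cardsC t; rewrite card_ord; lia.
apply/ffunP=> j; rewrite !ffunE.
have jt : j < size (enum t) by rewrite -cardE tk.
have jtC : j < size (enum (~: t)) by rewrite -cardE tCk.
have := mem_nth ord0 jt; rewrite mem_enum => ->.
have := mem_nth ord0 jtC; rewrite mem_enum inE => /negbTE->.
by rewrite !index_uniq ?enum_uniq // inord_val; case: (w j).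
Qed.

Definition zeros (C : V -> bool) s : {set 'I_(2 * k.+1)} :=
  [set i | ~~ C (s i)].

(** Coordinates in [t] carry first components and the others second components, so the colors tell
    them apart whichever pair is placed there. *)
Lemma zeros_spread (C : V -> bool) t w :
  (forall j, ~~ C (w j).1 && C (w j).2) -> zeros C (spread t w) = t.
Proof.
move=> Cw; apply/setP=> i; rewrite inE ffunE.
by case: ifP => _; [case/andP: (Cw (inord (index i (enum t))))
  | case/andP: (Cw (inord (index i (enum (~: t))))) => _ ->].
Qed.

End Placements.

(** Serves to name codewords by ordinals; [e] and [e'] involve no oracle, so applying them costs no
    query. *)
Lemma injection_into (T : finType) (A : {set T}) (n : nat) (i0 : 'I_n) :
  n <= #|A| ->
  {e : 'I_n -> T & {e' : T -> 'I_n | cancel e e' & forall i, e i \in A}}.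
Proof.
move=> nA; pose e i : T := enum_val (widen_ord nA i).
exists e, (fun y => odflt i0 [pick i | e i == y]) => [i|i].
  case: pickP => [j /eqP /enum_val_inj [] /val_inj //|/(_ i)].
  by rewrite eqxx.
exact: enum_valP.
Qed.

(** * Counting estimates *)

(** Induction through [(k+1) C(2k+2, k+1) = 2 (2k+1) C(2k, k)]; the step comes down to
    [2 (k+1)^2 <= (k+2) (2k+1)]. *)
Lemma expn4_central_binomial (k : nat) : 4 ^ k <= k.+1 * 'C(2 * k, k).
Proof.
elim: k => [|k IH]; first by rewrite bin0.
have e1 : k.+1 * 'C(2 * k.+1, k.+1) = 2 * (2 * k).+1 * 'C(2 * k, k).
  have h1 := mul_bin_diag (2 * k).+1 k.
  have h2 := mul_bin_down (2 * k).+1 k.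
  have h3 := binS (2 * k).+1 k.
  rewrite (_ : 2 * k.+1 = (2 * k).+2); last lia.
  rewrite /= in h1 h2.
  rewrite (_ : (2 * k).+1 - k = k.+1) in h2; last lia.
  nia.
rewrite expnS; set b := 'C(2 * k.+1, _) in e1 *; set a := 'C(_, _) in e1 IH.
rewrite -(leq_pmul2l (ltn0Sn k)) (mulnCA k.+1 k.+2) e1.
apply: leq_trans (_ : 4 * (k.+1 * (k.+1 * a)) <= _); nia.
Qed.

Section Reals.

Import Order.TTheory GRing.Theory Num.Theory.
Local Open Scope ring_scope.

Context (R : realType) (c : R) (hc : 1 < c).

(* Bernoulli only gives a linear bound [1 + m d <= c ^ m] without control on the
   slope [d]; squaring it beats any linear function. *)
Lemma expr_ge_linear : exists k : nat, (2 * k.+2)%N%:R <= c ^+ k.+1.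
Proof.
pose d := c - 1; have d0 : 0 < d by rewrite subr_gt0.
have bernoulli n : 1 + n%:R * d <= c ^+ n.
  elim: n => [|n IH]; first by rewrite expr0; lra.
  have n0 : 0 <= n%:R * d by rewrite mulr_ge0 ?ler0n ?ltW.
  by rewrite exprS -[n.+1]addn1 natrD; move: IH; rewrite /d in d0 n0 *; nra.
(* With [k.+1 = 2 * m], squaring gives [c ^+ k.+1 >= (m d)^2 > 6 m >= 2 (2 m + 1)], the last because
   [1 <= m]. *)
pose m := Num.bound (6 / d ^+ 2).
have hm : 6 / d ^+ 2 < m%:R.
  by apply: archi_boundP; rewrite divr_ge0 ?exprn_ge0 ?ltW.
have m6 : 6 < m%:R * d ^+ 2 by rewrite -ltr_pdivrMr ?exprn_gt0.
have m1 : 1 <= m%:R :> R.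
  rewrite ler1n lt0n; apply/eqP => m0; move: m6; rewrite m0; lra.
have [k mk] : exists k, (2 * m)%N = k.+1.
  by exists (2 * m).-1; rewrite prednK // muln_gt0 /= -(ltr0n R); lra.
exists k; rewrite -mk.
rewrite (mulnC 2%N m) exprM expr2.
have md0 : 0 <= m%:R * d by rewrite mulr_ge0 ?ler0n ?ltW.
have md : m%:R * d <= c ^+ m by have := bernoulli m; lra.
apply: le_trans (ler_pM md0 md0 md md).
rewrite -[(m * _).+1]addn1 !(natrM, natrD); move: m6; rewrite expr2; nra.
Qed.

Lemma pigeonsE (N : nat) : (pigeons c N)%:Z = Num.ceil (c * N%:R ^+ 2).
Proof.
rewrite /pigeons gez0_abs // ceil_ge0; apply: lt_le_trans (ltrN10 R) _.
by rewrite mulr_ge0 ?exprn_ge0 // ltW // (lt_trans ltr01).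
Qed.

Lemma pigeons_ge (N : nat) : c * N%:R ^+ 2 <= (pigeons c N)%:R.
Proof. by rewrite (pmulrn _ (pigeons c N)) pigeonsE ceil_ge. Qed.

Lemma pigeons_le (N a : nat) : c <= a%:R -> (pigeons c N <= a * N ^ 2)%N.
Proof.
move=> ca; rewrite -lez_nat pigeonsE ceil_le_int -pmulrn natrM natrX.
by rewrite ler_wpM2r ?exprn_ge0.
Qed.

Lemma placements_ge (k N : nat) :
  (2 * k.+2)%N%:R <= c ^+ k.+1 ->
  (2 * (2 * N) ^ (2 * k.+1) <= 'C(2 * k.+1, k.+1) * pigeons c N ^ k.+1)%N.
Proof.
have c0 : 0 <= c by rewrite ltW // (lt_trans ltr01).
move=> kc.
(* The factor [k.+2] pays for the loss in the central binomial bound; the remaining 2 is the stretch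
   of Lossy-Code. *)
have pk : (2 * k.+2 * N ^ (2 * k.+1) <= pigeons c N ^ k.+1)%N.
  rewrite -(ler_nat R) natrM !natrX.
  apply: le_trans (_ : (c * N%:R ^+ 2) ^+ k.+1 <= _).
    by rewrite exprMn -exprM ler_wpM2r ?exprn_ge0.
  by apply: lerXn2r; rewrite ?nnegrE ?pigeons_ge ?mulr_ge0 ?exprn_ge0.
rewrite expnMn expnM -[(2 ^ 2)%N]/4%N.
have := leq_mul (expn4_central_binomial k.+1) (leqnn (N ^ (2 * k.+1))).
have := leq_mul (leqnn 'C(2 * k.+1, k.+1)) pk.
set x := 'C(_, _); set y := (N ^ _)%N; set z := (4 ^ _)%N; set w := (_ ^ _)%N.
move=> h1 h2; apply: leq_trans h1; lia.
Qed.

End Reals.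

(** * Query costs for AMGM, and folding of pigeon tuples *)

Section Amgm.

Context (p N : nat).
Implicit Types (x : amgm_lc_input p N) (e : 'I_(2 * N) * 'I_(2 * N)).

Notation bit := (@amgm_lc_bit p N).

Definition amgm_solution x i :=
  (amgm_G x (amgm_F x i) != i) || (amgm_F x i \notin bichromatic x).

Lemma bichromaticE x e :
  (e \in bichromatic x) = ~~ coloring x e.1 && coloring x e.2.
Proof. by rewrite !inE; do 2 case: (coloring x _). Qed.

Lemma computable_coloring v : computable bit 1 (fun x => coloring x v).
Proof. exact: (computable_query bit (inl (inl v))). Qed.

Lemma computable_F (v0 : 'I_(2 * N)) i :
  computable bit (2 * code_length (2 * N)) (fun x => amgm_F x i).
Proof.
have c1 : computable bit (code_length (2 * N) * 1) (fun x => (amgm_F x i).1).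
  apply: (computable_ord v0) => j.
  exact: (computable_query bit (inl (inr (i, inl j)))).
have c2 : computable bit (code_length (2 * N) * 1) (fun x => (amgm_F x i).2).
  apply: (computable_ord v0) => j.
  exact: (computable_query bit (inl (inr (i, inr j)))).
rewrite muln1 in c1 c2.
apply: (computable_le (d := code_length (2 * N) + code_length (2 * N))).
  by lia.
apply: computable_ext (computable_bind c1
  (k := fun a x => (a, (amgm_F x i).2)) _) => [x|a].
  by case: (amgm_F x i).
exact: computable_map (pair a) c2.
Qed.

Lemma computable_G (i0 : 'I_p) e :
  computable bit (code_length p) (fun x => amgm_G x e).
Proof.
rewrite -[code_length p]muln1; apply: (computable_ord i0) => j.
exact: (computable_query bit (inr (e, j))).
Qed.

Lemma computable_amgm_solution (v0 : 'I_(2 * N)) i :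
  computable bit (2 * code_length (2 * N) + (code_length p + (1 + 1)))
    (fun x => amgm_solution x i).
Proof.
apply: computable_ext (computable_bind (computable_F v0 i)
  (k := fun e x => (amgm_G x e != i) ||
                   ~~ (~~ coloring x e.1 && coloring x e.2)) _) => [x|e].
  by rewrite /amgm_solution bichromaticE.
apply: (computable_bind (computable_G i e)
  (k := fun j x => (j != i) ||
                   ~~ (~~ coloring x e.1 && coloring x e.2))) => j.
apply: (computable_bind (computable_coloring e.1)
  (k := fun a x => (j != i) || ~~ (~~ a && coloring x e.2))) => a.
exact: (computable_map (fun b => (j != i) || ~~ (~~ a && b))
  (computable_coloring e.2)).
Qed.

Context (k : nat).
Implicit Types (s : {ffun 'I_(2 * k.+1) -> 'I_(2 * N)})
  (u : {set 'I_(2 * k.+1)} * {ffun 'I_k.+1 -> 'I_p}).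

(* Total: on strings that are not balanced, [gather] returns junk letters, but
   then the first component is not a [k.+1]-set. *)
Definition fold_pigeons x s : {set 'I_(2 * k.+1)} * {ffun 'I_k.+1 -> 'I_p} :=
  let t := zeros (coloring x) s in (t, [ffun j => amgm_G x (gather t s j)]).

Definition unfold_pigeons x u : {ffun 'I_(2 * k.+1) -> 'I_(2 * N)} :=
  spread u.1 [ffun j => amgm_F x (u.2 j)].

(** Non-solutions have bichromatic images, so the colors return [u.1], and [amgm_G] undoes [amgm_F]
    on each pigeon. Hence a failed round trip on a balanced [u] exposes a solution among the pigeons
    of [u.2]. *)
Lemma unfold_pigeonsK x u :
  #|u.1| = k.+1 -> (forall j, ~~ amgm_solution x (u.2 j)) ->
  fold_pigeons x (unfold_pigeons x u) = u.
Proof.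
case: u => t w /= tk nsol; rewrite /fold_pigeons /unfold_pigeons zeros_spread.
  rewrite spreadK //; congr pair; apply/ffunP=> j; rewrite !ffunE /=.
  by have := nsol j; rewrite negb_or negbK => /andP[/eqP].
move=> j; rewrite ffunE /=.
by have := nsol j; rewrite negb_or !negbK bichromaticE => /andP[].
Qed.

(** The [2 * k.+1] colors determine [t]; only then are the [k.+1] edges at which to query [amgm_G]
    known. *)
Lemma computable_fold_pigeons (i0 : 'I_p) s :
  computable bit (2 * k.+1 * 1 + k.+1 * code_length p)
    (fun x => fold_pigeons x s).
Proof.
have cz : computable bit (#|'I_(2 * k.+1)| * 1)
    (fun x => zeros (coloring x) s).
  have := computable_ffun false (fun i => computable_coloring (s i)).
  move/(computable_map (fun w : {ffun _ -> bool} => [set i | ~~ w i])).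
  apply: computable_ext => x; apply/setP=> i.
  by rewrite !inE ffunE.
rewrite card_ord in cz.
apply: (computable_bind cz
  (k := fun t x => (t, [ffun j => amgm_G x (gather t s j)]))) => t.
apply: (computable_map (pair t)).
have := computable_ffun i0 (fun j => computable_G i0 (gather t s j)).
by rewrite card_ord.
Qed.

Lemma computable_unfold_pigeons (v0 : 'I_(2 * N)) u :
  computable bit (k.+1 * (2 * code_length (2 * N)))
    (fun x => unfold_pigeons x u).
Proof.
apply: (computable_map (spread u.1)).
have := computable_ffun (v0, v0) (fun j => computable_F v0 (u.2 j)).
by rewrite card_ord.
Qed.

End Amgm.

(** * Assembly of the reduction *)

Lemma amgm_lc_reduction (R : realType) (c : R) (k N : nat) :
  0 < N -> 2 * (2 * N) ^ (2 * k.+1) <=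
    'C(2 * k.+1, k.+1) * pigeons c N ^ k.+1 ->
  let M := (2 * N) ^ (2 * k.+1) in
  dt_reduces_within (amgm_lc c N) (lossy_code M)
    (up_log 2 (input_length (lossy_code M)) +
     k.+1 * (2 * code_length (2 * N) + (code_length (pigeons c N) + 2))).
Proof.
set p := pigeons c N => N0 Mp M; set d := k.+1 * _.
have v0 : 'I_(2 * N) by apply: (@Ordinal _ 0); lia.
have M0 : 0 < M by rewrite expn_gt0; lia.
(* Without pigeons, [Mp] would bound the positive number [2 * M] by 0. *)
have i0 : 'I_p.
  apply: (@Ordinal _ 0); rewrite lt0n; apply/eqP => p0.
  by move: Mp; rewrite p0 exp0n // muln0 -/M; lia.
have z0 : 'I_(2 * M) by apply: (@Ordinal _ 0); lia.
pose D := {ffun 'I_(2 * k.+1) -> 'I_(2 * N)}.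
have MD : #|{: D}| = M by rewrite card_ffun !card_ord.
pose T := {set 'I_(2 * k.+1)}.
(* The balanced placements with pigeon tuples; [Mp] says that there are at least [2 * M] of them. *)
pose A : {set T * {ffun 'I_k.+1 -> 'I_p}} :=
  setX [set t : T | #|t| == k.+1] setT.
have MA : 2 * M <= #|A|.
  by rewrite cardsX cardsT card_draws card_ffun !card_ord.
have [e [e' eK eA]] := injection_into z0 MA.
have ek z : #|(e z).1| = k.+1.
  by have := eA z; rewrite [e z]surjective_pairing !inE => /andP[/eqP].
(* [M] becomes literally [#|D|], the index type of [enum_val] and [enum_rank]. *)
clearbody M; subst M.
(* The solution map searches the tuple named by [z]. If it finds nothing it returns [i0], but then
   the round trip succeeds and [z] is no Lossy-Code solution. *)
apply: (@lossy_code_reduction (amgm_lc c N) _ d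
  (fun x i => e' (fold_pigeons x (enum_val i)))
  (fun x z => enum_rank (unfold_pigeons x (e z)))
  (fun x z => oapp (e z).2 i0 [pick j | amgm_solution x ((e z).2 j)])).
- move=> i; apply: (computable_map e').
  apply: computable_le (computable_fold_pigeons i0 _).
  by rewrite -/p /d; nia.
- move=> z; apply: (computable_map enum_rank).
  apply: computable_le (computable_unfold_pigeons v0 _).
  by rewrite /d; nia.
- move=> z; apply: (computable_map (oapp (e z).2 i0)).
  have := computable_pick (fun j => computable_amgm_solution v0 ((e z).2 j)).
  by rewrite card_ord.
- move=> x z; case: pickP => [j xj _ //|nsol] /=.
  rewrite enum_rankK unfold_pigeonsK ?eK ?eqxx // => j.
  by rewrite nsol.
Qed.

Theorem theorem1p8 (R : realType) (c : R) (hc : (1 < c)%R) :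
  dt_reducible (amgm_lc c) lossy_code.
Proof.
have [k kc] := expr_ge_linear hc.
pose a := Num.bound c.
have ca : (c <= a%:R)%R.
  by rewrite Order.POrderTheory.ltW ?Num.Theory.archi_boundP //; move: hc; lra.
(* [4 * k.+1 + 2] covers the log of the input length and the last summand the depth, each as a
   multiple of [L.+1]. *)
pose B := 4 * k.+1 + 2 + k.+1 * (a + 4).
exists B => N N0; exists ((2 * N) ^ (2 * k.+1)).
  by rewrite expn_gt0; lia.
have [T [U [d [xy dT dU cost]]]] :=
  amgm_lc_reduction N0 (placements_ge hc N kc).
exists T, U, d; split=> //; apply: leq_trans cost _.
set L := up_log 2 N.
have NL : N <= 2 ^ L by apply: up_logP.
have NL1 : 2 * N <= 2 ^ L.+1 by rewrite expnS leq_mul2l.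
have VL : code_length (2 * N) <= L.+1 by apply: up_log_min.
have pL : code_length (pigeons c N) <= a + 2 * L.
  apply: up_log_min => //; apply: leq_trans (pigeons_le hc N ca) _.
  rewrite expnD (mulnC 2 L) expnM; apply: leq_mul.
    exact: ltnW (ltn_expl _ _).
  by rewrite leq_exp2r.
have ML : up_log 2 (input_length (lossy_code ((2 * N) ^ (2 * k.+1)))) <=
    (L.+1 * (2 * k.+1)).*2.+2.
  by apply: up_log_lossy_code; rewrite (expnM 2 L.+1) leq_exp2r.
have BL : B * L.+1 <= B * L.+1 ^ B.
  by rewrite leq_mul2l -{1}[L.+1]expn1 leq_pexp2l ?orbT.
apply: leq_trans BL; apply: leq_trans (leq_add ML (leqnn _)) _.
rewrite /B; move: VL pL; set x := code_length _; set y := code_length _; nia.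
Qed.
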